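(* Let $(\mathcal{A},E)$ be a non-commutative probability space, let $\pi$ be a cyclic representation of $\mathcal{A}$ on an infinite-dimensional Hilbert space $H$ and $\xi\in H$ its cyclic vector. Let $n\ge1$, let $X_1,\dots,X_n\in\mathcal{A}$ be free identically-distributed random variables, and let $\Pi_n=X_1X_2\cdots X_n$. Then $$n^{-1}\log\|\pi(\Pi_n)\xi\|=\log\sqrt{E(X_i^*X_i)}.$$
   Context: A non-commutative probability space $(\mathcal{A},E)$ is a unital $C^*$-algebra $\mathcal{A}$ with a positive linear functional $E$ such that $E(I)=1$ and which is tracial: $E(AB)=E(BA)$ for all $A,B\in\mathcal{A}$. Elements of $\mathcal{A}$ are called random variables (not necessarily self-adjoint). A ($*$-)representation $\pi$ of $\mathcal{A}$ on a Hilbert space $H$ is called cyclic (in the sense of this paper) if there is a vector $\xi\in H$ such that $E(X)=\langle\xi,\pi(X)\xi\rangle$ for all $X\in\mathcal{A}$; such a vector $\xi$ is called cyclic. Freeness: unital subalgebras $\mathcal{A}_1,\dots,\mathcal{A}_r$ of $\mathcal{A}$ are free if $E(a_1\cdots a_m)=0$ whenever $a_i\in\mathcal{A}_{k(i)}$, $E(a_i)=0$ for all $i$, $k(i)\ne k(i+1)$ for every $i<m$, and $k(m)\neq k(1)$. (Since $E$ is tracial, this is equivalent to the usual definition without the condition $k(m)\ne k(1)$.) Elements (not necessarily self-adjoint) are free if the unital $*$-subalgebras they generate are free. Variables $X_i$ are identically distributed if all mixed moments of $(X_i,X_i^* )$ under $E$ do not depend on $i$. Convention: $\log 0=-\infty$.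 *)

(* Defs.v *)
From HB Require Import structures.
From mathcomp Require Import all_boot all_order all_algebra.
From mathcomp Require Import complex.
From mathcomp Require Import all_classical all_reals all_analysis.

Set Implicit Arguments.
Unset Strict Implicit.
Unset Printing Implicit Defensive.

Import Order.TTheory GRing.Theory Num.Theory.
Import numFieldNormedType.Exports.

Local Open Scope classical_set_scope.
Local Open Scope ring_scope.

(* The norm of a C*-algebra is a field of its own, with values in R: the
   hierarchy has no common substructure of rings and of normed modules from
   which both numDomainType and C*-algebras could inherit. *)
HB.mixin Record isCStarAlgebra (R : realType) A of GRing.Algebra R[i] A := {
  star : A -> A;
  starK : involutive star;
  starD : {morph star : x y / x + y};
  starZ : forall (c : R[i]) (x : A), star (c *: x) = Num.conj c *: star x;
  starM : forall x y : A, star (x * y) = star y * star x;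
  cnorm : A -> R;
  cnorm_eq0 : forall x : A, cnorm x = 0 -> x = 0;
  cnormD_le : forall x y : A, cnorm (x + y) <= cnorm x + cnorm y;
  cnormZ : forall (c : R[i]) (x : A), cnorm (c *: x) = complex.Re `|c| * cnorm x;
  cnormM_le : forall x y : A, cnorm (x * y) <= cnorm x * cnorm y;
  cnorm_starM : forall x : A, cnorm (star x * x) = cnorm x ^+ 2;
  cnorm_complete : forall u : nat -> A,
    (cnorm (u p.1 - u p.2) @[p --> (\oo, \oo)] --> (0 : R)) ->
    exists l : A, cnorm (u n - l) @[n --> \oo] --> (0 : R)
}.

#[short(type="cstarAlgType")]
HB.structure Definition CStarAlgebra (R : realType) :=
  {A of GRing.Algebra R[i] A & isCStarAlgebra R A}.

HB.mixin Record isHilbert (R : realType) H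
    of CompleteNormedModule R[i] H := {
  hdot : {dot H for @Num.conj R[i]};
  hdotE : forall u : H, `|u| ^+ 2 = hdot u u
}.

#[short(type="hilbertType")]
HB.structure Definition Hilbert (R : realType) :=
  {H of CompleteNormedModule R[i] H & isHilbert R H}.

(* {dot _ for conj} is linear in its left argument; the inner product used
   here is the one that is linear in the right argument, without which
   X |-> inner xi (pi X xi) would not be linear. *)
Definition inner (R : realType) (H : hilbertType R) (u v : H) : R[i] :=
  hdot v u.

(* Norms of modules over R[i] take their values in R[i]; they are nonnegative
   there, hence equal to their real part. *)
Definition rnorm (R : realType) (V : normedModType R[i]) (v : V) : R :=
  complex.Re `|v|.

Definition infinite_dimensional (K : fieldType) (V : lmodType K) : Prop :=
  forall (d : nat) (e : 'I_d -> V),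
    exists v : V, forall c : 'I_d -> K, v <> \sum_(i < d) c i *: e i.

Section NCProbability.
Variables (R : realType) (A : cstarAlgType R).
Implicit Type E : {scalar A}.

(* (A, E) is a non-commutative probability space. *)
Record tracial_state E : Prop := TracialState {
  tracial_state1 : E 1 = 1;
  tracial_state_ge0 : forall x, 0 <= E (star x * x);
  tracial_stateC : forall x y, E (x * y) = E (y * x)
}.

Record unital_star_subalgebra (B : set A) : Prop := UnitalStarSubalgebra {
  subalgebra1 : B 1;
  subalgebraD : forall x y, B x -> B y -> B (x + y);
  subalgebraM : forall x y, B x -> B y -> B (x * y);
  subalgebraZ : forall (c : R[i]) x, B x -> B (c *: x);
  subalgebra_star : forall x, B x -> B (star x)
}.

Definition star_generated (x : A) : set A :=
  smallest unital_star_subalgebra [set x].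

(* Freeness of a family of subalgebras, for words of length m + 1. The last
   condition on k, k(m) <> k(1) in 1-based indexing, loses no generality for a
   tracial E. *)
Definition free_subalgebras E (I : eqType) (B : I -> set A) : Prop :=
  forall (m : nat) (k : 'I_m.+1 -> I) (a : 'I_m.+1 -> A),
    (forall i, B (k i) (a i)) ->
    (forall i, E (a i) = 0) ->
    (forall i j : 'I_m.+1, j = i.+1 :> nat -> k i != k j) ->
    k ord_max != k ord0 ->
    E (\prod_(i < m.+1) a i) = 0.

Definition free_variables E (I : eqType) (X : I -> A) : Prop :=
  free_subalgebras E (fun i => star_generated (X i)).

(* A word in the letters x (false) and star x (true). *)
Definition star_word (x : A) (w : seq bool) : A :=
  \prod_(b <- w) (if b then star x else x).

Definition identically_distributed E (I : eqType) (X : I -> A) : Prop :=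
  forall (w : seq bool) (i j : I), E (star_word (X i) w) = E (star_word (X j) w).

Variable H : hilbertType R.

(* A star-homomorphism into the bounded operators of H; pi 1 = 1 is not
   required, so degenerate representations are allowed. *)
Record star_representation (pi : A -> H -> H) : Prop := StarRepresentation {
  repr_linear_op : forall x, linear (pi x);
  repr_continuous : forall x, continuous (pi x);
  repr_linear : forall (c : R[i]) x y v, pi (c *: x + y) v = c *: pi x v + pi y v;
  repr_mul : forall x y v, pi (x * y) v = pi x (pi y v);
  repr_star : forall x u v, inner (pi (star x) u) v = inner u (pi x v)
}.

Definition cyclic_vector E (pi : A -> H -> H) (xi : H) : Prop :=
  forall x, E x = inner xi (pi x xi).

End NCProbability.

(* Main.v *)
Require Import Defs.
From HB Require Import structures.
From mathcomp Require Import all_boot all_order all_algebra.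
From mathcomp Require Import complex.
From mathcomp Require Import all_classical all_reals all_analysis zify.

Set Implicit Arguments.
Unset Strict Implicit.
Unset Printing Implicit Defensive.

Import Order.TTheory GRing.Theory Num.Theory.
Import numFieldNormedType.Exports.

Local Open Scope ring_scope.

(* With the usual notion of freeness (no condition on the two ends of a word),
   E (P^* u P) vanishes for every alternating word u of centered letters and
   every product P of further free variables: split each variable of P, from
   the inside out, into its mean and a centered part.  Replacing the central
   X_1^* X_1 of P^* P, where P = X_1 ... X_n, by its mean thus changes nothing,
   and repeating this gives E (P^* P) = E (X_1^* X_1) ... E (X_n^* X_n).
   Moreover E (P^* P) is the square of the norm of pi(P) xi. *)

Section StarAlgebra.
Variables (R : realType) (A : cstarAlgType R).

Lemma star1 : star (1 : A) = 1.
Proof. by rewrite -[LHS]mulr1 -{2}(starK 1) -starM mulr1 starK. Qed.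

Lemma star_generated_subalgebra (x : A) :
  unital_star_subalgebra (star_generated x).
Proof.
split.
- by move=> B [[]].
- move=> y z hy hz B BP.
  by case: (BP) => -[_ BD _ _ _] _; apply: BD; [apply: hy|apply: hz].
- move=> y z hy hz B BP.
  by case: (BP) => -[_ _ BM _ _] _; apply: BM; [apply: hy|apply: hz].
- by move=> c y hy B BP; case: (BP) => -[_ _ _ BZ _] _; apply: BZ; apply: hy.
- by move=> y hy B BP; case: (BP) => -[_ _ _ _ BS] _; apply: BS; apply: hy.
Qed.

Lemma mem_star_generated (x : A) : star_generated x x.
Proof. by move=> B [_]; apply. Qed.

End StarAlgebra.

Section Freeness.
Variables (R : realType) (A : cstarAlgType R) (E : {scalar A}).
Hypothesis AE : tracial_state E.

Definition center (x : A) : A := x - (E x)%:A.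

Lemma expectation_center x : E (center x) = 0.
Proof.
by rewrite /center linearB linearZ /= (tracial_state1 AE) mulr1 subrr.
Qed.

Lemma mean_add_center x : (E x)%:A + center x = x.
Proof. by rewrite addrC subrK. Qed.

Lemma center_mem (B : set A) x :
  unital_star_subalgebra B -> B x -> B (center x).
Proof.
move=> BP Bx; apply: (subalgebraD BP) => //; rewrite -scaleNr.
exact: subalgebraZ (subalgebra1 BP).
Qed.

(** When [E y = 0] the mean of [x] drops out, so the last factor of a product may be replaced by its
    centered part. *)
Lemma expectation_mul_split x y :
  E (y * x) = E x * E y + E (y * center x).
Proof.
by rewrite -{1}(mean_add_center x) mulrDr linearD -scalerAr mulr1 linearZ.
Qed.

(** * Alternating words in free subalgebras *)

Variables (I : eqType) (B : I -> set A).
Hypothesis B_alg : forall i, unital_star_subalgebra (B i).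
Hypothesis B_free : free_subalgebras E B.
Implicit Types (u w : seq (I * A)) (p q : I * A).

(** Letters carry their index: an element may lie in several of the [B i], so it does not determine
    one. *)
Definition centered_letters w :=
  forall p, p \in w -> B p.1 p.2 /\ E p.2 = 0.

Definition alternating w := sorted (fun p q => p.1 != q.1) w.

Definition word_prod w : A := \prod_(p <- w) p.2.

Lemma word_prod_cons p w : word_prod (p :: w) = p.2 * word_prod w.
Proof. exact: big_cons. Qed.

Lemma word_prod_rcons p w : word_prod (rcons w p) = word_prod w * p.2.
Proof. by rewrite /word_prod -cats1 big_cat big_seq1. Qed.

Lemma centered_letters_cons p w :
  B p.1 p.2 -> E p.2 = 0 -> centered_letters w -> centered_letters (p :: w).
Proof. by move=> Bp Ep cw q; rewrite inE => /predU1P[->|/cw]. Qed.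

Lemma centered_letters_rcons p w :
  B p.1 p.2 -> E p.2 = 0 -> centered_letters w -> centered_letters (rcons w p).
Proof.
by move=> Bp Ep cw q; rewrite mem_rcons; apply: centered_letters_cons.
Qed.

Lemma centered_letters_sub w u :
  {subset w <= u} -> centered_letters u -> centered_letters w.
Proof. by move=> wu cu p /wu /cu. Qed.

(** Freeness restated for lists. For empty [w] the end condition reads [p.1 != p.1], so one-letter
    words are excluded here. *)
Lemma expectation_cyclic_word p w :
  centered_letters (p :: w) -> alternating (p :: w) ->
  (last p w).1 != p.1 -> E (word_prod (p :: w)) = 0.
Proof.
move=> cw aw lw.
pose k (i : 'I_(size w).+1) := nth p (p :: w) i.
have kw i : k i \in p :: w by apply: mem_nth; rewrite /= ltn_ord.
have := B_free (k := fun i => (k i).1) (a := fun i => (k i).2).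
rewrite /word_prod (big_nth p) big_mkord; apply.
- by move=> i; case: (cw _ (kw i)).
- by move=> i; case: (cw _ (kw i)).
- move=> i j ij; rewrite /k ij.
  have hi : (i < size w)%N by rewrite -ltnS -ij ltn_ord.
  exact: (pathP p aw).
- by rewrite /k /= nth_last.
Qed.

(* A word whose two ends lie in the same subalgebra is rotated by traciality,
   so that the two ends merge. *)
Lemma expectation_word w :
  w != [::] -> centered_letters w -> alternating w -> E (word_prod w) = 0.
Proof.
have [m] := ubnP (size w); elim: m w => // m IHm [//|p s] sz _ cw aw.
case: (lastP s) sz cw aw => [|s' q] sz cw aw.
  by rewrite /word_prod big_seq1; case: (cw p (mem_head _ _)).
have [qp|qp] := eqVneq q.1 p.1; last first.
  by apply: expectation_cyclic_word; rewrite ?last_rcons.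
(* The interior is nonempty: otherwise [p] and [q] would be adjacent letters of equal index. *)
case: s' sz cw aw => [|r s'] sz cw aw.
  by move: aw; rewrite /alternating /= qp eqxx.
have [Bp _] := cw p (mem_head _ _).
have [Bq _] : B q.1 q.2 /\ E q.2 = 0.
  by apply: cw; rewrite inE mem_rcons mem_head orbT.
have cv : centered_letters (r :: s').
  by apply: centered_letters_sub cw => x xv; rewrite inE mem_rcons inE xv !orbT.
rewrite /alternating /= rcons_path in aw; have /and3P[_ av lq] := aw.
rewrite word_prod_cons word_prod_rcons (tracial_stateC AE) -mulrA.
(* The merged letter [q.2 * p.2] need not be centered. Its mean multiplies the expectation of the
   interior, two letters shorter; its centered part closes a word one letter shorter. Both vanish by
   induction. *)
rewrite expectation_mul_split (IHm (r :: s')) //; last first.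
  by move: sz; rewrite /= size_rcons; lia.
rewrite mulr0 add0r -(word_prod_rcons (q.1, _)) IHm //.
- by move: sz; rewrite /= !size_rcons; lia.
- apply: centered_letters_rcons => //=; last exact: expectation_center.
  by apply: center_mem => //; apply: subalgebraM => //; rewrite qp.
- by rewrite /alternating /= rcons_path av.
Qed.

(** * Moments of products of free variables *)

Variable X : I -> A.
Hypothesis BX : forall i, B i (X i).

(** Induction on [s] for all [w], because the head of [s] is the factor next to [w] and gets
    absorbed into it. Its index is new to [w] and absent from the rest of [s], so the longer words
    still qualify. *)
Lemma expectation_conj_word (s : seq I) w :
  uniq s -> (forall p, p \in w -> p.1 \notin s) ->
  w != [::] -> centered_letters w -> alternating w ->
  E (star (\prod_(i <- s) X i) * word_prod w * \prod_(i <- s) X i) = 0.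
Proof.
elim: s w => [|i s IHs] w.
  move=> _ _ w0 cw aw; rewrite !big_nil star1 mul1r mulr1.
  exact: expectation_word.
move=> /= /andP[si us] ws w0 cw aw; rewrite big_cons starM.
set P := \prod_(j <- s) X j.
pose a := (i, center (X i)); pose b := (i, center (star (X i))).
have [Ba Bb] : B i a.2 /\ B i b.2.
  by split; apply: center_mem => //; apply: subalgebra_star.
have Ea : E a.2 = 0 := expectation_center _.
have Eb : E b.2 = 0 := expectation_center _.
case: w w0 ws cw aw => // p w _ ws cw aw.
have ww q : q \in p :: w -> q.1 \notin s.
  by move=> /ws; rewrite inE negb_or => /andP[].
have wi q : q \in p :: w -> q.1 != i.
  by move=> /ws; rewrite inE negb_or => /andP[].
have ip : i != p.1 by rewrite eq_sym wi ?mem_head.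
have li : (last p w).1 != i by rewrite wi ?mem_last.
have ca := centered_letters_rcons (p := a) Ba Ea cw.
have aa : alternating (rcons (p :: w) a).
  by rewrite /alternating /= rcons_path; apply/andP.
have wa q : q \in rcons (p :: w) a -> q.1 \notin s.
  by rewrite mem_rcons inE => /predU1P[->|/ww].
have zero u : (forall q, q \in u -> q.1 \notin s) -> u != [::] ->
    centered_letters u -> alternating u -> E (star P * word_prod u * P) = 0.
  exact: IHs us.
(* The four words [w], [w a], [b w], [b w a] come from expanding both neighbours of [w] into mean
   plus centered part. As [w] is nonempty, it separates [b] from [a], which share the index [i]. *)
have E1 := zero _ ww isT cw aw.
have E2 := zero _ wa isT ca aa.
have E3 : E (star P * word_prod (b :: p :: w) * P) = 0.
  apply: zero => //; first by move=> q; rewrite inE => /predU1P[->|/ww].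
    exact: centered_letters_cons.
  by apply/andP.
have E4 : E (star P * word_prod (b :: rcons (p :: w) a) * P) = 0.
  apply: zero => //; first by move=> q; rewrite inE => /predU1P[->|/wa].
    exact: centered_letters_cons.
  by apply/andP.
move: E1 E2 E3 E4; rewrite !(word_prod_cons b) !word_prod_rcons.
set U := word_prod (p :: w) => E1 E2 E3 E4.
pose c := E (star (X i)); pose d := E (X i).
have starXi : star (X i) = c%:A + b.2 by rewrite mean_add_center.
have Xi : X i = d%:A + a.2 by rewrite mean_add_center.
have -> : star P * star (X i) * U * (X i * P) =
    (c * d) *: (star P * U * P) + c *: (star P * (U * a.2) * P) +
    (d *: (star P * (b.2 * U) * P) + star P * (b.2 * (U * a.2)) * P).
  rewrite starXi [X in _ * (X * P)]Xi !(mulrDl, mulrDr).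
  rewrite -!(scalerAl, scalerAr) !mul1r !mulr1 !mulrA.
  by rewrite scalerA !scalerDr.
by rewrite !linearD !linearZ /= E1 E2 E3 E4 !mulr0 !addr0.
Qed.

Lemma expectation_star_prod (s : seq I) : uniq s ->
  E (star (\prod_(i <- s) X i) * \prod_(i <- s) X i) =
  \prod_(i <- s) E (star (X i) * X i).
Proof.
elim: s => [|i s IHs] /=.
  by rewrite !big_nil star1 mulr1 (tracial_state1 AE).
move=> /andP[si us]; rewrite !big_cons starM.
set P := \prod_(j <- s) X j; set y := star (X i) * X i.
have -> : star P * star (X i) * (X i * P) =
    E y *: (star P * P) + star P * center y * P.
  rewrite -[in LHS]mulrA (mulrA (star (X i))) -/y -{1}(mean_add_center y).
  by rewrite mulrDl mulrDr -scalerAl mul1r -scalerAr !mulrA.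
rewrite linearD linearZ /= IHs //.
(* The centered part of [y] is a one-letter word whose index lies outside [s]. *)
have := @expectation_conj_word s [:: (i, center y)] us.
rewrite /word_prod big_seq1 /= => ->; rewrite ?addr0 //.
  by move=> p; rewrite inE => /eqP ->.
move=> p; rewrite inE => /eqP -> /=; split; last exact: expectation_center.
by apply: center_mem => //; apply: subalgebraM => //; apply: subalgebra_star.
Qed.

End Freeness.

(** * Norms, logarithms and the conclusion *)

Lemma rnormE (R : realType) (V : normedModType R[i]) (v : V) :
  (rnorm v)%:C%C = `|v|.
Proof. by rewrite RRe_real // normr_real. Qed.

Lemma rnorm_ge0 (R : realType) (V : normedModType R[i]) (v : V) : 0 <= rnorm v.
Proof. by rewrite -(@lecR R) rnormE normr_ge0. Qed.

(** Moving [pi (star x)] across the inner product leaves the square of a norm; moment identities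
    thus become equations between reals. *)
Lemma expectation_star_mul_rnorm (R : realType) (A : cstarAlgType R)
    (E : {scalar A}) (H : hilbertType R) (pi : A -> H -> H) (xi : H) (x : A) :
  star_representation pi -> cyclic_vector E pi xi ->
  E (star x * x) = (rnorm (pi x xi) ^+ 2)%:C%C.
Proof.
move=> pi_rep xi_cyclic.
rewrite xi_cyclic (repr_mul pi_rep) -(repr_star pi_rep) starK /inner -hdotE.
by rewrite rmorphXn /= rnormE.
Qed.

Lemma lne_exprn (R : realType) (n : nat) (r : R) : (0 < n)%N -> 0 <= r ->
  ((n%:R^-1)%:E * lne (r ^+ n)%:E)%E = lne r%:E.
Proof.
move=> n0; rewrite le_eqVlt => /predU1P[<-|r0].
  (* For [r = 0] both sides are minus infinity: [0 ^+ n = 0] since [n] is positive, and so is the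
     factor [n%:R^-1]. *)
  rewrite expr0n gtn_eqF // le0_lneNy // gt0_muleNy ?lte_fin //.
  by rewrite invr_gt0 ltr0n.
rewrite !lne_EFin ?exprn_gt0 // lnXn // -EFinM -[ln r *+ n]mulr_natl mulKf //.
by rewrite pnatr_eq0 -lt0n.
Qed.

(* MathComp-Analysis *)
Theorem theorem3 (R : realType)
  (A : cstarAlgType R) (E : {scalar A}) (AE : tracial_state E)
  (H : hilbertType R) (Hinf : infinite_dimensional H)
  (pi : A -> H -> H) (pi_rep : star_representation pi)
  (xi : H) (xi_cyclic : cyclic_vector E pi xi)
  (n : nat) (n_ge1 : (1 <= n)%N) (X : 'I_n -> A)
  (X_free : free_variables E X) (X_id : identically_distributed E X) :
  forall i : 'I_n,
    ((n%:R^-1)%:E * lne (rnorm (pi (\prod_(j < n) X j) xi))%:E)%E =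
    lne (Num.sqrt (complex.Re (E (star (X i) * X i))))%:E.
Proof.
move=> i.
have X_gen j : star_generated (X j) (X j) by apply: mem_star_generated.
have gen_alg j := star_generated_subalgebra (X j).
have same j : E (star (X j) * X j) = E (star (X i) * X i).
  have := X_id [:: true; false] j i.
  by rewrite /star_word !big_cons !big_nil !mulr1.
have := expectation_star_prod AE gen_alg X_free X_gen (index_enum_uniq 'I_n).
rewrite (expectation_star_mul_rnorm _ pi_rep xi_cyclic).
rewrite (eq_bigr _ (fun j _ => same j)) prodr_const card_ord.
rewrite (expectation_star_mul_rnorm _ pi_rep xi_cyclic) /=.
set r := rnorm _; set t := rnorm _.
have [r0 t0] : 0 <= r /\ 0 <= t by split; apply: rnorm_ge0.
rewrite -rmorphXn /= => -[] rt.
(* [rt] equates [r ^+ 2] with [(t ^+ 2) ^+ n]; nonnegativity allows taking square roots. *)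
have -> : r = t ^+ n.
  by apply/eqP; rewrite -(@eqrXn2 _ 2) ?exprn_ge0 // rt -!exprM mulnC.
by rewrite sqrtr_sqr ger0_norm // lne_exprn.
Qed.
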